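(* Let $p$ be a prime and let $\mathcal{C}$ be a linear $[n,k,d]_p$ code with $k\ge2$. Then either (1) $\mathcal{C}$ is MDS, in which case \[d_L(\mathcal{C})\le\left\lfloor\mu_p(n-k+1)\cdot\frac{p-1}{p}\right\rfloor+1;\] or (2) $\operatorname{def}(\mathcal{C})=s>0$, in which case \[d_L(\mathcal{C})\le\mu_p(n-k+1-s)\le\mu_p(n-k).\]
   Context: A linear $[n,k,d]_p$ code is a $k$-dimensional subspace of $\mathbb{Z}_p^n$ with minimum Hamming distance $d$; it is MDS if $d=n-k+1$, and its Singleton defect is $\operatorname{def}(\mathcal{C})=n-k+1-d$. The Lee weight of $a\in\mathbb{Z}_p$ (as an integer in $\{0,\dots,p-1\}$) is $\min\{a,p-a\}$, the Lee weight of a vector is the sum over coordinates, and $d_L(\mathcal{C})$ is the minimum Lee weight of a nonzero codeword. $\mu_p$ is the average Lee weight of the nonzero elements of $\mathbb{Z}_p$: $\mu_2=1$ and $\mu_p=\frac{p+1}{4}$ for odd $p$. *)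

(* Defs.v *)
From HB Require Import structures.
From mathcomp Require Export all_boot all_order all_algebra.
From mathcomp Require Import zify ring.

Set Implicit Arguments.
Unset Strict Implicit.
Unset Printing Implicit Defensive.

Import Order.TTheory GRing.Theory Num.Theory.
Local Open Scope ring_scope.

(* For prime p, 'F_p is Z_p, and the coercion of a : 'F_p to nat is its
   representative in {0, ..., p-1}. *)
Definition lee (p : nat) (a : 'F_p) : nat := minn a (p - a).

Definition lee_weight (p n : nat) (x : 'rV['F_p]_n) : nat :=
  (\sum_(i < n) lee (x 0%R i))%N.

Definition hamming_dist (p n : nat) (x y : 'rV['F_p]_n) : nat :=
  #|[set i : 'I_n | x 0 i != y 0 i]|.

(* The seeds (vpick C, 0) and vpick C of the two minima below belong to the
   minimization ranges whenever C is not the zero code. *)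
Definition min_distance (p n : nat) (C : {vspace 'rV['F_p]_n}) : nat :=
  let xy := [arg min_(xy < (vpick C, 0)
               | [&& xy.1 \in C, xy.2 \in C & xy.1 != xy.2])
               hamming_dist xy.1 xy.2] in
  hamming_dist xy.1 xy.2.

Definition min_lee_weight (p n : nat) (C : {vspace 'rV['F_p]_n}) : nat :=
  lee_weight [arg min_(x < vpick C | (x \in C) && (x != 0)) lee_weight x].

Definition linear_code (p n k d : nat) (C : {vspace 'rV['F_p]_n}) : Prop :=
  \dim C = k /\ min_distance C = d.

(* Integer-valued, so that no subtraction is truncated. *)
Definition singleton_defect (p n : nat) (C : {vspace 'rV['F_p]_n}) : int :=
  n%:Z - (\dim C)%:Z + 1 - (min_distance C)%:Z.

Definition MDS (p n : nat) (C : {vspace 'rV['F_p]_n}) : Prop :=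
  (min_distance C)%:Z = n%:Z - (\dim C)%:Z + 1.

Definition mu (p : nat) : rat :=
  (\sum_(a : 'F_p | a != 0) (lee a)%:R) / #|[set a : 'F_p | a != 0]|%:R.

Lemma mu2 : mu 2 = 1.
Proof.
rewrite /mu (_ : [set a : 'F_2 | a != 0] = [set 1]); last first.
  by apply/setP => -[[|[|m]] im]; rewrite !inE.
rewrite cards1 divr1 (bigD1 1) //= big1 ?addr0 //.
by case=> [[|[|m]] im] /andP[].
Qed.

Lemma sum_id (m : nat) : (\sum_(0 <= i < m.+1) i)%N.*2 = (m * m.+1)%N.
Proof.
elim: m => [|m IH]; first by rewrite big_nat1.
by rewrite big_nat_recr //= doubleD IH; nia.
Qed.

Lemma sum_minn (m : nat) :
  (\sum_(0 <= i < m.*2.+1) minn i (m.*2.+1 - i))%N = (m * m.+1)%N.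
Proof.
rewrite (@big_cat_nat _ _ _ m.+1) //=; last by rewrite ltnS -addnn leq_addr.
rewrite -sum_id -[RHS]addnn; congr (_ + _)%N.
  apply: eq_big_nat => i /andP[_ im]; apply/minn_idPl.
  by lia.
rewrite [RHS]big_ltn // add0n -[in LHS](add0n m.+1) big_addn.
rewrite (_ : m.*2.+1 - m.+1 = m)%N; last by lia.
rewrite big_nat_rev /= [RHS]big_add1 /=.
by apply: eq_big_nat => i /andP[_ im]; lia.
Qed.

Lemma mu_odd (p : nat) : prime p -> odd p -> mu p = (p%:R + 1) / 4%:R.
Proof.
move=> p_pr p_odd; have p_gt0 := prime_gt0 p_pr; have p_gt1 := prime_gt1 p_pr.
rewrite /mu -natr_sum.
have -> : #|[set a : 'F_p | a != 0]| = p.-1.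
  have -> : [set a : 'F_p | a != 0] = [set~ 0] by apply/setP => a; rewrite !inE.
  by rewrite cardsC1 card_Fp.
have -> : (\sum_(a : 'F_p | a != 0%R) lee a = \sum_(a : 'F_p) lee a)%N.
  by rewrite [RHS](bigD1 (0 : 'F_p)) //= {2}/lee min0n add0n.
rewrite /lee -(big_mkord xpredT (fun i => minn i (p - i))) Fp_cast //.
have [m pE] : exists m, p = m.*2.+1.
  by exists p./2; rewrite -[LHS]odd_double_half p_odd.
rewrite pE sum_minn /= natrM -!natr1 -mul2n natrM.
have m_neq0 : (m%:R : rat) != 0 by rewrite pnatr_eq0; lia.
by field.
Qed.

(* Main.v *)
(* Averaging. The nonzero multiples of a word of minimum Hamming weight d have
   mean Lee weight mu_p d, which settles the case of positive defect.  In an MDS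
   code any k - 1 coordinates are the exact zero set of some codeword.  Pick two
   such words v and u whose zero sets Z and Z' differ by exchanging one i in Z
   for one j outside Z, and scale u so that u_i = 1.  Along the line u + t v the
   coordinate i always has Lee weight 1, the other coordinates of Z vanish, and
   each of the d = n - k + 1 remaining ones runs once through Z_p; hence the mean
   Lee weight of the line is 1 + mu_p d (p - 1) / p. *)
Require Import Defs.
From mathcomp Require Import zify lra.

Set Implicit Arguments.
Unset Strict Implicit.
Unset Printing Implicit Defensive.

Import Order.TTheory GRing.Theory Num.Theory.
Local Open Scope ring_scope.

(** * Codewords with prescribed zeros, and the minimum distance *)

(** Restriction to the coordinates in [S] maps [C] to a space of smaller dimension, so its kernel on
    [C] is nonzero. *)
Lemma exists_vanishing (F : fieldType) (n : nat) (C : {vspace 'rV[F]_n})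
    (S : {set 'I_n}) :
  (#|S| < \dim C)%N ->
  exists x, [/\ x \in C, x != 0 & forall i, i \in S -> x 0 i = 0].
Proof.
move=> ltSC.
pose f := linfun (mxsub id (fun j : 'I_#|S| => enum_val j)
                  : 'rV[F]_n -> 'rV[F]_#|S|).
have dim_img : (\dim (f @: C) <= #|S|)%N.
  by apply: leq_trans (dimvS (subvf _)) _; rewrite dimvf /dim /= mul1n.
pose U := (C :&: lker f)%VS.
have U_neq0 : U != 0%VS.
  rewrite -dimv_eq0 -lt0n -(ltn_add2r (\dim (f @: C))) limg_ker_dim.
  exact: leq_ltn_trans dim_img ltSC.
have := memv_pick U; rewrite memv_cap memv_ker => /andP[xC /eqP fx0].
exists (vpick U); split; rewrite ?vpick0 // => i iS.
have := congr1 (fun y : 'rV__ => y 0 (enum_rank_in iS i)) fx0.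
by rewrite lfunE /= !mxE enum_rankK_in.
Qed.

Definition hamming_weight (p n : nat) (x : 'rV['F_p]_n) : nat :=
  #|[set i : 'I_n | x 0 i != 0]|.

Section Code.

Variables (p n : nat) (C : {vspace 'rV['F_p]_n}).

Lemma min_distance_le x :
  x \in C -> x != 0 -> (min_distance C <= hamming_weight x)%N.
Proof.
move=> xC x0; rewrite /min_distance /=.
have C0 : vpick C != 0 by rewrite vpick0; apply: contraNneq x0 => C0;
  rewrite C0 memv0 in xC.
(* The competing pair is [(x, 0)], whose distance is the weight of [x]. *)
case: arg_minnP => [|xy _ /(_ (x, 0))]; rewrite /= mem0v ?memv_pick ?xC //.
move=> /(_ x0) /leq_trans -> //; apply/subset_leq_card/subsetP => i.
by rewrite !inE mxE.
Qed.

Lemma min_distance_attained :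
  C != 0%VS ->
  exists x, [/\ x \in C, x != 0 & hamming_weight x = min_distance C].
Proof.
rewrite -vpick0 /min_distance => C0 /=.
case: arg_minnP => [|[x y] /= /and3P[xC yC xy] _].
  by rewrite /= mem0v memv_pick.
exists (x - y); split; rewrite ?memvB ?subr_eq0 //.
by apply: eq_card => i; rewrite !inE !mxE subr_eq0.
Qed.

Lemma min_lee_weight_le x :
  x \in C -> x != 0 -> (min_lee_weight C <= lee_weight x)%N.
Proof.
move=> xC x0; rewrite /min_lee_weight.
have C0 : vpick C != 0 by rewrite vpick0; apply: contraNneq x0 => C0;
  rewrite C0 memv0 in xC.
by case: arg_minnP => [|y _ -> //]; rewrite ?memv_pick ?xC.
Qed.

Lemma hamming_weight_vanishing (S : {set 'I_n}) (x : 'rV['F_p]_n) :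
  (forall i, i \in S -> x 0 i = 0) -> (hamming_weight x + #|S| <= n)%N.
Proof.
move=> xS; rewrite -[leqRHS]card_ord -(cardsC S) addnC leq_add2l.
apply/subset_leq_card/subsetP => i; rewrite !inE.
by apply: contraNN => /xS ->.
Qed.

(** Some nonzero codeword vanishes on any chosen k - 1 coordinates, here the first ones. *)
Lemma singleton_bound : (0 < \dim C)%N -> (min_distance C + \dim C <= n.+1)%N.
Proof.
move=> C0; have le_n : (\dim C <= n)%N.
  by apply: leq_trans (dimvS (subvf _)) _; rewrite dimvf /dim /= mul1n.
have : exists S : {set 'I_n}, #|S| = (\dim C).-1.
  have le_n' : ((\dim C).-1 <= n)%N by lia.
  exists [set widen_ord le_n' j | j : 'I_(\dim C).-1].
  by rewrite card_imset ?card_ord // => i j [/val_inj].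
case=> S cS; have [|x [xC x0 xS]] := @exists_vanishing _ _ C S; first by rewrite cS prednK.
by have := min_distance_le xC x0; have := hamming_weight_vanishing xS; lia.
Qed.

(** The support of [x] lies in the complement of [S], which has exactly [min_distance C] elements;
    the support has at least that many, so the two coincide. *)
Lemma MDS_support (S : {set 'I_n}) (x : 'rV['F_p]_n) :
    (min_distance C + #|S| = n)%N -> x \in C -> x != 0 ->
    (forall i, i \in S -> x 0 i = 0) ->
  forall i, (x 0 i != 0) = (i \notin S).
Proof.
move=> cS xC x0 xS i.
have sub : [set i | x 0 i != 0] \subset ~: S.
  by apply/subsetP => j; rewrite !inE; apply: contraNN => /xS ->.
have /eqP/setP/(_ i) : [set i | x 0 i != 0] == ~: S.
  rewrite eqEcard sub; apply: leq_trans (min_distance_le xC x0).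
  by rewrite -(leq_add2l #|S|) cardsC card_ord addnC cS.
by rewrite !inE.
Qed.

End Code.

(** * Averages of Lee weights *)

Section Averages.

Variables (p : nat) (p_prime : prime p).

Lemma lee0 : lee (0 : 'F_p) = 0%N.
Proof. by rewrite /lee min0n. Qed.

Lemma lee1 : lee (1 : 'F_p) = 1%N.
Proof.
rewrite /lee /= Fp_cast // modn_small ?prime_gt1 //.
by apply/minn_idPl; have := prime_gt1 p_prime; lia.
Qed.

(** For nonzero [b], the map sending t to a + t b permutes the field. *)
Lemma sum_lee_line (a b : 'F_p) :
  b != 0 -> (\sum_(t : 'F_p) lee (a + t * b)%R = \sum_(t : 'F_p) lee t)%N.
Proof.
move=> b0; rewrite [RHS](reindex (fun t => a + t * b)) //=.
exists (fun t => (t - a) / b) => t _; first by rewrite addrC addKr mulfK.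
by rewrite divfK // addrC subrK.
Qed.

Lemma sum_leeE : (\sum_(a : 'F_p) lee a)%N%:R = mu p * (p%:R - 1) :> rat.
Proof.
have p1 : (p%:R - 1 : rat) != 0.
  by rewrite subr_eq0 pnatr_eq1; have := prime_gt1 p_prime; lia.
have -> : p%:R - 1 = #|[set a : 'F_p | a != 0]|%:R :> rat.
  have -> : [set a : 'F_p | a != 0] = [set~ 0] by apply/setP => a; rewrite !inE.
  by rewrite cardsC1 card_Fp // -subn1 natrB // prime_gt0.
rewrite /mu divfK; last first.
  rewrite pnatr_eq0 -lt0n; apply/card_gt0P; exists 1; rewrite inE.
  exact: oner_neq0.
by rewrite natr_sum (bigD1 (0 : 'F_p)) //= lee0 add0r.
Qed.

Lemma mu_ge0 : 0 <= mu p.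
Proof. by rewrite /mu -natr_sum divr_ge0 ?ler0n. Qed.

Lemma min_lee_weight_le_mu n (C : {vspace 'rV['F_p]_n}) x :
  x \in C -> x != 0 -> (min_lee_weight C)%:R <= mu p * (hamming_weight x)%:R.
Proof.
move=> xC x0; have p_gt1 := prime_gt1 p_prime.
have p1 : 0 < (p%:R - 1 : rat) by rewrite subr_gt0 ltr1n.
rewrite -(ler_pM2r p1) mulrAC -sum_leeE.
have -> : p%:R - 1 = (p.-1)%:R :> rat by rewrite -subn1 natrB //; lia.
rewrite -!natrM ler_nat.
have -> : (min_lee_weight C * p.-1 =
           \sum_(t : 'F_p | t != 0%R) min_lee_weight C)%N.
  by rewrite sum_nat_const cardC1 card_Fp // mulnC.
have le_sum : (\sum_(t : 'F_p | t != 0%R) min_lee_weight C <=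
               \sum_(t : 'F_p | t != 0%R) lee_weight (t *: x))%N.
  apply: leq_sum => t t0; apply: min_lee_weight_le; first exact: memvZ.
  by rewrite scaler_eq0 negb_or t0.
apply: leq_trans le_sum _.
(* Admitting t = 0 lets each coordinate in the support run through the whole field. *)
apply: (@leq_trans (\sum_(t : 'F_p) lee_weight (t *: x))).
  by rewrite [leqRHS](bigID (fun t : 'F_p => t != 0)) leq_addr.
rewrite exchange_big /= (bigID (fun i => x 0 i == 0)) /= big1 ?add0n; last first.
  by move=> i /eqP xi; apply: big1 => t _; rewrite mxE xi mulr0 lee0.
rewrite (eq_bigr (fun=> \sum_(t : 'F_p) lee t)%N) => [|i xi]; last first.
  by rewrite -(sum_lee_line 0 xi); apply: eq_bigr => t _; rewrite mxE add0r.
by rewrite sum_nat_const mulnC /hamming_weight cardsE.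
Qed.

(** This is the average over the p words of the line, multiplied by p to stay in the natural
    numbers. *)
Lemma MDS_min_lee_weight n (C : {vspace 'rV['F_p]_n}) :
    (1 < \dim C)%N -> (min_distance C + \dim C = n.+1)%N ->
  (min_lee_weight C * p <=
     p + min_distance C * \sum_(a : 'F_p) lee a)%N.
Proof.
move=> C2 mdsC.
have C0 : C != 0%VS by rewrite -dimv_eq0; lia.
have [v [vC v0 wv]] := min_distance_attained C0.
pose Z := [set i | v 0 i == 0].
have cZ : (#|Z| = (\dim C).-1)%N.
  have wvE : #|~: Z| = min_distance C.
    by rewrite -wv; apply: eq_card => i; rewrite !inE.
  by have := cardsC Z; rewrite wvE card_ord; lia.
(* Dimension at least 2 enters here: [Z] has k - 1 elements, so there is an i to exchange. *)
have /card_gt0P[i iZ] : (0 < #|Z|)%N by lia.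
have /existsP[j jZ] : [exists j, v 0 j != 0].
  apply: contraNT v0; rewrite negb_exists => /forallP vj.
  by apply/eqP/rowP => j; have := vj j; rewrite negbK mxE => /eqP.
have jNZ : j \notin Z by rewrite inE.
pose Z' := j |: Z :\ i.
have cZ' : #|Z'| = #|Z|.
  by rewrite cardsU1 !inE (negbTE jZ) andbF (cardsD1 i Z) iZ.
have [|u [uC u0 uZ']] := @exists_vanishing _ _ C Z'; first by rewrite cZ' cZ prednK //; lia.
(* The zeros of [u] are exactly [Z'], and i was removed from it. *)
have ui : u 0 i != 0.
  rewrite (MDS_support _ uC u0 uZ'); last by rewrite cZ' cZ; lia.
  by rewrite !inE eqxx orbF; apply: contraNneq jNZ => <-.
pose w t := (u 0 i)^-1 *: u + t *: v.
have wi t : w t 0 i = 1.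
  by rewrite !mxE mulVf //; move: iZ; rewrite inE => /eqP ->; rewrite mulr0 addr0.
have wC t : w t \in C by rewrite memvD // memvZ.
have w0 t : w t != 0.
  apply: contraTneq (oner_neq0 'F_p) => wt0.
  by rewrite -(wi t) wt0 mxE eqxx.
have -> : (min_lee_weight C * p = \sum_(t : 'F_p) min_lee_weight C)%N.
  by rewrite sum_nat_const card_Fp // mulnC.
apply: (@leq_trans (\sum_(t : 'F_p) lee_weight (w t))).
  by apply: leq_sum => t _; apply: min_lee_weight_le.
(* Summing by coordinates, those in [Z] contribute p in total, all of it from i; each one outside
   [Z] has a nonzero slope [v 0 l] and contributes the full Lee sum. *)
rewrite exchange_big /= (bigID (mem Z)) /= leq_add //.
  rewrite (bigD1 i) //= [X in (_ + X)%N]big1 ?addn0 => [|l /andP[lZ li]].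
    rewrite (eq_bigr (fun=> 1%N)) => [|t _]; last by rewrite wi lee1.
    by rewrite sum_nat_const card_Fp // muln1.
  apply: big1 => t _; rewrite !mxE (uZ' l); last by rewrite in_setU1 in_setD1 li lZ orbT.
  by move: lZ; rewrite inE => /eqP ->; rewrite !mulr0 addr0 lee0.
rewrite (eq_bigr (fun=> \sum_(t : 'F_p) lee t)%N) => [|l lZ]; last first.
  rewrite inE in lZ; rewrite -(sum_lee_line ((u 0 i)^-1 * u 0 l) lZ).
  by apply: eq_bigr => t _; rewrite !mxE.
rewrite sum_nat_const leq_mul2r -wv /hamming_weight; apply/orP; right.
by apply/subset_leq_card/subsetP => l; rewrite unfold_in /= !inE.
Qed.

End Averages.

Theorem theorem17 (p n k d : nat) (C : {vspace 'rV['F_p]_n})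
    (p_prime : prime p) (codeC : linear_code k d C) (k_ge2 : (2 <= k)%N) :
  (MDS C /\
     (min_lee_weight C)%:Z <=
       Num.floor (mu p * (n%:R - k%:R + 1) * ((p%:R - 1) / p%:R)) + 1)
  \/
  (exists s : int,
     [/\ singleton_defect C = s, 0 < s,
         (min_lee_weight C)%:R <= mu p * (n%:R - k%:R + 1 - s%:~R)
       & mu p * (n%:R - k%:R + 1 - s%:~R) <= mu p * (n%:R - k%:R)]).
Proof.
case: codeC => dimC _; have C_gt0 : (0 < \dim C)%N by lia.
have [mdsC|defC] := eqVneq (min_distance C + \dim C)%N n.+1.
  left; split; first by rewrite /MDS; lia.
  (* An integer is at most the floor of a rational exactly when it is at most that rational, so the
     floor disappears once the 1 is moved across. *)
  rewrite -lerBlDr floor_ge_int.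
  have p0 : 0 < (p%:R : rat) by rewrite ltr0n prime_gt0.
  have -> : n%:R - k%:R + 1 = (min_distance C)%:R :> rat.
    have := congr1 (fun m : nat => m%:R : rat) mdsC.
    by rewrite dimC /= natrD -natr1; lra.
  have C_gt1 : (1 < \dim C)%N by rewrite dimC.
  have := MDS_min_lee_weight p_prime C_gt1 mdsC.
  rewrite -(ler_nat rat) natrD !natrM sum_leeE // => le_avg.
  rewrite mulrA ler_pdivlMr // rmorphB /= -pmulrn mulrBl mul1r.
  by rewrite [mu p * _]mulrC -mulrA lerBlDl.
right; exists (singleton_defect C).
have defE : n%:R - k%:R + 1 - (singleton_defect C)%:~R =
            (min_distance C)%:R :> rat.
  by rewrite /singleton_defect dimC !rmorphB rmorphD rmorphB /= -!pmulrn; lra.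
have def_gt0 : 0 < singleton_defect C.
  by have := singleton_bound C_gt0; rewrite /singleton_defect; lia.
split=> //.
  have [|x [xC x0 wx]] := @min_distance_attained _ _ C.
    by rewrite -dimv_eq0 -lt0n.
  by rewrite defE -wx; apply: min_lee_weight_le_mu.
apply: ler_wpM2l; first exact: mu_ge0.
(* Integrality turns a positive defect into one of at least 1. *)
have : (1 : rat) <= (singleton_defect C)%:~R by rewrite -[1]/(1%:~R) ler_int.
by lra.
Qed.
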